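(* Fix integers $k\ge 2$ and $\ell\ge 0$ with $\ell<k/2$. Let $b_0=\frac{n}{2k\log n}$, let $D=n/(k-\ell)$, and let $Q$ be a set of $D$ colors. Then, for all sufficiently large $n$ divisible by $k-\ell$, Maker wins the Rainbow Hamilton $\ell$-cycle Game on $H_{n,k}$ with color set $Q$ and bias $b$ whenever $b\le b_0$.
   Context: $H_{n,k}$ is the complete $k$-uniform hypergraph on $n$ vertices. In a Maker-Breaker game with bias $b$ (a positive integer) on $H_{n,k}$, two players alternately claim previously unclaimed edges: in each round Maker first claims one edge and then Breaker claims $b$ edges (or all remaining edges, if fewer than $b$ remain). Play continues until all edges are claimed. ''Maker wins'' means that Maker has a winning strategy. A Hamilton $\ell$-cycle is, for some ordering $v_1,\dots,v_n$ of all the vertices, the sequence of $n/(k-\ell)$ edges $\{v_1,\dots,v_k\},\{v_{k-\ell+1},\dots,v_{2k-\ell}\},\dots$, i.e. the edges $\{v_{(k-\ell)j+1},\dots,v_{(k-\ell)j+k}\}$ for $0\le j<n/(k-\ell)$, with subscripts taken modulo $n$, so that each edge intersects the previous one in $\ell$ vertices. For $\ell=0$ a Hamilton $0$-cycle is a perfect matching, i.e. a set of $n/k$ pairwise disjoint edges covering all vertices. In the Rainbow Hamilton $\ell$-cycle Game, whenever Maker claims an edge she also gives it a color of her choice from $Q$; Maker wins if the colored hypergraph of the edges she has claimed contains a rainbow Hamilton $\ell$-cycle, i.e. a Hamilton $\ell$-cycle whose edges all have different colors. Here $\log$ is the natural logarithm. *)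

(* Defs.v *)
From mathcomp Require Import all_boot all_order all_algebra all_fingroup.
From mathcomp Require Import reals exp.

Set Implicit Arguments.
Unset Strict Implicit.
Unset Printing Implicit Defensive.

(* Biased Maker-Breaker games in which Maker colors the edges she claims.
   [E] is the type of edges, [board] the set of edges that are in play, [Q] the
   set of colors. A round consists of Maker's move and the set of edges with
   which Breaker answers; a history lists the rounds in chronological order. *)
Section Game.
Variables (E Q : finType).

Definition move : Type := (E * Q)%type.
Definition history : Type := seq (move * {set E}).
Definition strategy : Type := history -> move.

Definition maker_edges (h : history) : seq (E * Q) := [seq r.1 | r <- h].

Definition claimed (h : history) : {set E} :=
  \bigcup_(r <- h) (r.1.1 |: r.2).

Variables (board : {set E}) (b : nat).

Definition free (h : history) : {set E} := board :\: claimed h.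

(* The histories that can arise when Maker follows [s]. The legality of Maker's
   own moves is required in [winning_strategy], not here. *)
Inductive play (s : strategy) : history -> Prop :=
| play_start : play s [::]
| play_round (h : history) (B : {set E}) :
    play s h -> free h != set0 ->
    B \subset free h :\ (s h).1 ->
    #|B| = minn b #|free h :\ (s h).1| ->
    play s (rcons h (s h, B)).

Definition winning_strategy (win : seq (E * Q) -> Prop) (s : strategy) : Prop :=
  forall h : history, play s h ->
    (free h != set0 -> (s h).1 \in free h) /\
    (free h = set0 -> win (maker_edges h)).

Definition maker_wins (win : seq (E * Q) -> Prop) : Prop :=
  exists s : strategy, winning_strategy win s.

End Game.

Definition complete_hypergraph (n k : nat) : {set {set 'I_n}} :=
  [set e : {set 'I_n} | #|e| == k].

(* The ordering of the vertices is v 0, ..., v (n - 1), so indices start at 0. *)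
Definition ham_edge (n k l : nat) (v : 'S_n) (j : nat) : {set 'I_n} :=
  [set v i | i : 'I_n & [exists t : 'I_k, i == ((k - l) * j + t) %% n :> nat]].

Definition ham_cycle (n k l : nat) (v : 'S_n) : seq {set 'I_n} :=
  [seq ham_edge k l v j | j <- iota 0 (n %/ (k - l))].

(* [M] lists the edges of a colored hypergraph together with their colors. *)
Definition has_rainbow_ham_cycle (n k l : nat) (Q : finType)
    (M : seq ({set 'I_n} * Q)) : Prop :=
  exists (v : 'S_n) (c : {set 'I_n} -> Q),
    {in ham_cycle k l v, forall e, (e, c e) \in M} /\
    {in ham_cycle k l v &, injective c}.

Definition maker_wins_rainbow_ham (n k l : nat) (Q : finType) (b : nat) : Prop :=
  maker_wins (complete_hypergraph n k) b (@has_rainbow_ham_cycle n k l Q).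

(* Main.v *)
(* Fix the cyclic order of the vertices up to a permutation of [D] of them, one
   private vertex per edge of the cycle: edge [i] becomes a fixed (k-1)-set plus
   one of [D] vertices [x], and it always receives color [i]. A perfect matching
   of [K_{D,D}] then is a rainbow Hamilton cycle, so it suffices that Maker wins
   the perfect matching game on [K_{m,m}], [m = D], where [b <= m / (2 ln m)].

   Let [lam ^ b = 2], so that [lam ^ m >= m ^ (4/3)]. Beck's criterion applied to
   all Hall violators fails, because there are about [m ^ (2s - 1)] of them with
   [s] vertices on one side. Maker therefore starts with an opening of O(m)
   rounds in which she gives each vertex one neighbour, no vertex being used more
   than twice. A violator [S] with neighbourhood [N] is then contained in
   the preimage of [N], which leaves at most [4 ^ |N|] choices of [S] and makes
   the potential small. During the opening, a vertex at which Breaker has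
   claimed [q = m / 16] edges is endangered; Maker then claims an edge maximizing
   the sum of [lam ^ degree] over its two ends and sets both ends aside as
   matched for good. Few vertices are ever endangered, since Breaker
   claims only O(b m) edges during the opening. *)

Require Import Defs.
From mathcomp Require Import all_boot all_order all_algebra all_fingroup.
From mathcomp Require Import boolp reals exp.
From mathcomp Require Import zify ring lra.

Set Implicit Arguments.
Unset Strict Implicit.
Unset Printing Implicit Defensive.

Import Order.TTheory GRing.Theory Num.Theory.

(** * Positions of the game *)

Section Positions.
Variables (P : finType) (b : nat) (goal : {set P} -> Prop).

(** Maker is to move. Breaker may take fewer than [b] elements, because part of an answer in the
    original game can fall outside the auxiliary board [P]. *)
Inductive maker_win (M B : {set P}) : Prop :=
| maker_win_end : M :|: B = setT -> goal M -> maker_win M B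
| maker_win_move (e : P) : e \notin M :|: B ->
    (forall A : {set P}, A \subset ~: (e |: (M :|: B)) -> #|A| <= b ->
       maker_win (e |: M) (B :|: A)) ->
    maker_win M B.

End Positions.

(** * From won positions to a winning strategy on the original board *)

Section Transfer.
Variables (E Q P : finType) (board : {set E}) (b : nat).
Variables (eps : P -> E) (col : P -> Q) (e0 : E) (q0 : Q).
Hypothesis eps_inj : injective eps.
Hypothesis eps_board : forall p, eps p \in board.
Variable goal : {set P} -> Prop.

(** An element counts for Maker only if its edge was claimed with the prescribed color; every other
    claimed edge counts for Breaker. *)
Let posM (h : history E Q) : {set P} :=
  [set p | (eps p, col p) \in maker_edges h].
Let posB (h : history E Q) : {set P} :=
  [set p | eps p \in claimed h] :\: posM h.
Let good (h : history E Q) (p : P) : Prop :=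
  p \notin posM h :|: posB h /\
  forall A : {set P}, A \subset ~: (p |: (posM h :|: posB h)) -> #|A| <= b ->
    maker_win b goal (p |: posM h) (posB h :|: A).

Let strat (h : history E Q) : E * Q :=
  if [pick p | `[< good h p >]] is Some p then (eps p, col p)
  else if [pick e in Defs.free board h] is Some e then (e, q0) else (e0, q0).

Let claimed_rcons (h : history E Q) r :
  claimed (rcons h r) = claimed h :|: (r.1.1 |: r.2).
Proof. by rewrite /claimed -cats1 big_cat big_seq1. Qed.

Let mem_claimed (h : history E Q) (m : E * Q) :
  m \in maker_edges h -> m.1 \in claimed h.
Proof.
case/mapP=> r rh ->; rewrite /claimed.
elim: h rh => // r' h IH; rewrite inE big_cons => /orP[/eqP<-|/IH].
  by rewrite !inE eqxx.
by move=> H; rewrite in_setU H orbT.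
Qed.

Let posMB (h : history E Q) p :
  (p \in posM h :|: posB h) = (eps p \in claimed h).
Proof.
rewrite !inE; case: (boolP (_ \in maker_edges h)) => //= H.
by rewrite (mem_claimed H).
Qed.

Let strat_invariant h :
  maker_win b goal set0 set0 -> play board b strat h ->
  maker_win b goal (posM h) (posB h).
Proof.
move=> win0; elim=> {h} [|h B play_h IH free_h sB cB].
  have -> : posB ([::] : history E Q) = set0.
    by apply/setP=> p; rewrite !inE /claimed big_nil inE andbF.
  by have -> : posM ([::] : history E Q) = set0 by apply/setP=> p; rewrite !inE.
have sBc p : eps p \in B -> eps p \notin claimed h /\ eps p != (strat h).1.
  move=> /(subsetP sB); rewrite !inE => /andP[-> /andP[-> _]] //.
pose A := [set p | eps p \in B].
have cA : #|A| <= b.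
  have : #|A| <= #|B|.
    rewrite -(card_imset (mem A) eps_inj); apply: subset_leq_card.
    by apply/subsetP=> e /imsetP[p]; rewrite inE => pB ->.
  by move=> AB; apply: (leq_trans AB); rewrite cB geq_minl.
have posM_rcons p : (p \in posM (rcons h (strat h, B))) =
    ((eps p, col p) == strat h) || (p \in posM h).
  by rewrite !inE /maker_edges map_rcons mem_rcons inE.
have posB_rcons p : (p \in posB (rcons h (strat h, B))) =
    (p \notin posM (rcons h (strat h, B))) &&
    [|| eps p \in claimed h, eps p == (strat h).1 | eps p \in B].
  by rewrite in_setD [in X in _ && X]inE claimed_rcons !inE.
move: sBc posM_rcons posB_rcons; rewrite /strat; case: pickP => [p /asboolP[pf pA]|nogood].
  move=> sBc posM_rcons posB_rcons.
  have -> : posM (rcons h (eps p, col p, B)) = p |: posM h.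
    apply/setP=> p'; rewrite posM_rcons in_setU1; congr (_ || _).
    by apply/eqP/eqP => [[/eps_inj]|->].
  have -> : posB (rcons h (eps p, col p, B)) = posB h :|: A.
    apply/setP=> p'; rewrite posB_rcons posM_rcons.
    have eqp : ((eps p', col p') == (eps p, col p)) = (p' == p).
      by apply/eqP/eqP => [[/eps_inj]|->].
    rewrite eqp in_setU [p' \in A]inE (inj_eq eps_inj).
    have /= sBp := sBc p'; have pMB := posMB h p'.
    rewrite in_setU in pMB.
    move: pf; rewrite posMB => pf.
    have [->|p'p] /= := eqVneq p' p.
      case: (boolP (eps p \in B)) => [|_]; first by case/sBc => _ /=; rewrite eqxx.
      rewrite orbF; apply/esym/negbTE; apply: contra pf => pB.
      by rewrite -posMB in_setU pB orbT.
    case: (boolP (eps p' \in B)) => [/sBp[p'c _]|_].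
      by move: p'c; rewrite -pMB negb_or => /andP[-> _]; rewrite !orbT.
    rewrite !orbF /= -pMB; case: (boolP (p' \in posM h)) => //= p'M.
    by rewrite in_setD p'M.
  apply: pA => //; apply/subsetP=> p'; rewrite [p' \in A]inE => /sBc[p'c /= p'p].
  by rewrite in_setC in_setU1 posMB negb_or p'c andbT -(inj_eq eps_inj).
case: pickP => [e ef|nofree]; last first.
  by case/set0Pn: free_h => e; rewrite nofree.
move=> sBc posM_rcons posB_rcons.
(* A won position without a move that keeps the win is final: [P] is exhausted, and the filler moves
   on the rest of the board change nothing. *)
have full : posM h :|: posB h = setT.
  case: IH => // p pMB pA; have := nogood p.
  by move/negbT/asboolP; case; split.
have allc p : eps p \in claimed h by rewrite -posMB full inE.
have neps p : eps p != e.
  by apply: contraTneq ef => <-; rewrite inE allc.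
have -> : posM (rcons h (e, q0, B)) = posM h.
  apply/setP=> p; rewrite posM_rcons; case: eqP => // -[epe _].
  by have := neps p; rewrite epe eqxx.
have -> // : posB (rcons h (e, q0, B)) = posB h.
apply/setP=> p; rewrite posB_rcons posM_rcons allc andbT in_setD.
rewrite (_ : _ == _ = false); first by rewrite [p \in [set _ | _]]inE allc andbT.
by apply/eqP=> -[epe _]; have := neps p; rewrite epe eqxx.
Qed.

Lemma maker_wins_transfer (win : seq (E * Q) -> Prop) :
  (forall (M : {set P}) (L : seq (E * Q)),
     (forall p, p \in M -> (eps p, col p) \in L) -> goal M -> win L) ->
  maker_win b goal set0 set0 -> maker_wins board b win.
Proof.
move=> goal_win win0; exists strat => h play_h; split=> free_h.
  rewrite /strat; case: pickP => [p /asboolP[pf _]|_].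
    by rewrite !inE /= eps_board andbT -posMB.
  by case: pickP => [e //|nofree]; case/set0Pn: free_h => e; rewrite nofree.
have full p : p \in posM h :|: posB h.
  have : eps p \notin Defs.free board h by rewrite free_h inE.
  by rewrite posMB !inE eps_board andbT negbK.
case: (strat_invariant win0 play_h) => [_ gM|p]; last by rewrite full.
by apply: (goal_win (posM h)) => // p; rewrite inE.
Qed.

End Transfer.

(** * Hall's theorem *)

(* Rado's argument: if [x != y] both lie in [F i], at least one of them can be
   deleted from [F i] without violating the union condition. *)
Lemma hall_representatives (I T : finType) (F : I -> {set T}) :
  (forall S : {set I}, #|S| <= #|\bigcup_(i in S) F i|) ->
  exists phi : I -> T, injective phi /\ forall i, phi i \in F i.
Proof.
move: {2}(\sum_i #|F i|) (leqnn (\sum_i #|F i|)) => n.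
elim: n F => [|n IH] F leFn hallF.
  have I0 (i : I) : False.
    have := hallF [set i]; rewrite cards1 big_set1.
    move: leFn; rewrite (bigD1 i) //=; lia.
  by exists (fun i => False_rect T (I0 i)); split=> i; case: (I0 i).
case: (boolP [exists i, 1 < #|F i|]) => [/existsP[i /card_gt1P[x [y [xFi yFi xy]]]]|small].
  pose G z j := if j == i then F i :\ z else F j.
  have leG z : z \in F i -> \sum_j #|G z j| <= n.
    move=> zFi; rewrite -ltnS; apply: leq_trans leFn.
    rewrite (bigD1 i) //= [in X in _ < X](bigD1 i) //= /G eqxx.
    rewrite [in X in _ < X + _](cardsD1 z) zFi add1n addSn ltnS leq_add2l.
    by apply: leq_sum => j /negbTE->.
  have GF z : z \in F i ->
      (forall S : {set I}, #|S| <= #|\bigcup_(j in S) G z j|) ->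
      exists phi : I -> T, injective phi /\ forall j, phi j \in F j.
    move=> zFi hallG; case: (IH _ (leG z zFi) hallG) => phi [phi_inj phiG].
    exists phi; split=> // j; have := phiG j; rewrite /G; case: eqP => // ->.
    by rewrite inE => /andP[].
  case: (boolP [forall S : {set I}, #|S| <= #|\bigcup_(j in S) G x j|]).
    by move/forallP; apply: GF.
  rewrite negb_forall => /existsP[Sx]; rewrite -ltnNge => badx.
  case: (boolP [forall S : {set I}, #|S| <= #|\bigcup_(j in S) G y j|]).
    by move/forallP; apply: GF.
  rewrite negb_forall => /existsP[Sy]; rewrite -ltnNge => bady.
  exfalso.
  have inS z (S : {set I}) : #|\bigcup_(j in S) G z j| < #|S| -> i \in S.
    move=> bad; apply: contraLR bad => iS; rewrite -leqNgt.
    apply: leq_trans (hallF S) _; apply: subset_leq_card.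
    apply/bigcupsP=> j jS; apply: (bigcup_max j) => //; rewrite /G.
    by case: eqP jS iS => // -> ->.
  have iSx := inS _ _ badx; have iSy := inS _ _ bady.
  set Ux := \bigcup_(j in Sx) G x j in badx.
  set Uy := \bigcup_(j in Sy) G y j in bady.
  (* Since [x != y], [Ux] and [Uy] together still cover [F i]. Hall's condition for [Sx :|: Sy] and
     for [(Sx :&: Sy) :\ i] gives [#|Ux| + #|Uy| >= #|Sx| + #|Sy| - 1], but the two violations give
     at most [#|Sx| + #|Sy| - 2]. *)
  have U : \bigcup_(j in Sx :|: Sy) F j \subset Ux :|: Uy.
    apply/bigcupsP=> j jS; apply/subsetP=> z zF; rewrite in_setU.
    have [ji|ji] := eqVneq j i.
      have [zx|zx] := eqVneq z x.
        apply/orP; right; apply/bigcupP; exists i => //.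
        by rewrite /G eqxx !inE zx xy xFi.
      apply/orP; left; apply/bigcupP; exists i => //.
      by rewrite /G eqxx !inE zx -ji.
    move: jS; rewrite in_setU => /orP[jS|jS]; apply/orP; [left|right];
      by apply/bigcupP; exists j => //; rewrite /G (negbTE ji).
  have V : \bigcup_(j in (Sx :&: Sy) :\ i) F j \subset Ux :&: Uy.
    apply/bigcupsP=> j; rewrite !inE => /andP[ji /andP[jx jy]].
    rewrite subsetI; apply/andP; split; apply: (bigcup_max j) => //;
      by rewrite /G (negbTE ji).
  have := leq_trans (hallF _) (subset_leq_card U).
  have := leq_trans (hallF _) (subset_leq_card V).
  have iSI : i \in Sx :&: Sy by rewrite inE iSx.
  have := cardsD1 i (Sx :&: Sy); rewrite iSI.
  have := cardsUI Sx Sy; have := cardsUI Ux Uy.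
  move: badx bady; lia.
have F1 i : #|F i| == 1.
  have := hallF [set i]; rewrite cards1 big_set1 eqn_leq => ->; rewrite andbT.
  by rewrite leqNgt; apply: contra small => ?; apply/existsP; exists i.
have Fx i : {x | F i == [set x]}.
  by apply: sigW; have /cards1P[x ->] := F1 i; exists x.
pose phi i := sval (Fx i).
have Fphi i : F i = [set phi i] by apply/eqP/(svalP (Fx i)).
exists phi; split=> [i j ij|i]; last by rewrite Fphi set11.
apply/eqP/negPn/negP=> ij'; have := hallF [set i; j].
by rewrite cards2 ij' big_setU1 ?inE //= big_set1 !Fphi ij setUid cards1.
Qed.

(** * Beck's criterion *)

Section Potential.
Local Open Scope ring_scope.
Variables (R : realType) (b : nat) (lam : R).
Hypothesis lam_gt1 : 1 < lam.
Hypothesis lamXb : lam ^+ b = 2.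

Let lam_ge1 : 1 <= lam. Proof. exact: ltW. Qed.
Let lam_gt0 : 0 < lam. Proof. exact: lt_trans lam_gt1. Qed.

Let b_gt0 : (0 < b)%N.
Proof. by case: b lamXb => // /eqP; rewrite expr0 (eqr_nat R 1 2). Qed.

(* Convexity of [lam ^+ d], which equals 1 at [d = 0] and 2 at [d = b]. *)
Lemma expr_le_chord (d : nat) : (d <= b)%N -> lam ^+ d <= 1 + d%:R / b%:R.
Proof.
have b0 : 0 < b%:R :> R by rewrite ltr0n.
move=> db.
suff : b%:R * (lam ^+ d - 1) <= d%:R * (lam ^+ b - 1).
  by rewrite lamXb => H; rewrite -lerBlDl ler_pdivlMr //; lra.
rewrite !subrX1 mulrCA [leRHS]mulrCA ler_pM2l ?subr_gt0 //.
rewrite -(subnKC db); move: (b - d)%N => e.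
rewrite [in leRHS]big_split_ord /=.
have S0 : 0 <= \sum_(i < d) lam ^+ i by apply: sumr_ge0 => i _; rewrite exprn_ge0 ?ltW.
have Sd : \sum_(i < d) lam ^+ i <= d%:R * lam ^+ d.
  rewrite -[d in leRHS]card_ord mulr_natl -sumr_const; apply: ler_sum => i _.
  by rewrite card_ord; apply: ler_weXn2l => //; apply: ltnW.
have Se : e%:R * lam ^+ d <= \sum_(i < e) lam ^+ (d + i).
  rewrite -[e in leLHS]card_ord mulr_natl -sumr_const; apply: ler_sum => i _.
  by apply: ler_weXn2l => //; apply: leq_addr.
have d0 : 0 <= d%:R :> R by [].
have e0 : 0 <= e%:R :> R by [].
rewrite natrD; nra.
Qed.

(** By [expr_le_chord] the factor of [i] is at most 1 plus [1 / b] for each element of [A] incident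
    with [i]. After exchanging the sums, each of the at most [b] elements of [A] contributes at most
    [g / b]. *)
Lemma breaker_gain (I E : finType) (P : pred I) (w : I -> R)
    (inc : I -> E -> bool) (A : {set E}) (g : R) :
  (forall i, P i -> 0 <= w i) -> (#|A| <= b)%N -> 0 <= g ->
  (forall e, e \in A -> \sum_(i | P i && inc i e) w i <= g) ->
  \sum_(i | P i) w i * lam ^+ #|[set e in A | inc i e]|
    <= \sum_(i | P i) w i + g.
Proof.
move=> w0 Ab g0 Hg.
have b0 : 0 < b%:R :> R by rewrite ltr0n.
apply: (@le_trans _ _ (\sum_(i | P i) (w i + w i * #|[set e in A | inc i e]|%:R / b%:R))).
  apply: ler_sum => i Pi; rewrite -mulrA -[X in X + _]mulr1 -mulrDr.
  apply: ler_wpM2l; first exact: w0.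
  apply: expr_le_chord; apply: leq_trans Ab; apply: subset_leq_card.
  by apply/subsetP=> e; rewrite inE => /andP[].
rewrite big_split /= lerD2l -mulr_suml ler_pdivrMr //.
rewrite (eq_bigr (fun i => \sum_(e in A | inc i e) w i)); last first.
  by move=> i _; rewrite -sum1dep_card natr_sum mulr_sumr; apply: eq_bigr => e _; rewrite mulr1.
rewrite (exchange_big_dep (fun e => e \in A)) /=; last by move=> i e _ /andP[].
apply: (@le_trans _ _ (\sum_(e in A) g)).
  apply: ler_sum => e eA; rewrite (eq_bigl (fun i => P i && inc i e)) ?Hg // => i.
  by rewrite eA.
by rewrite sumr_const -[_ *+ _]mulr_natr ler_wpM2l // ler_nat.
Qed.

(* Maker claims an edge of maximal total weight; by [breaker_gain] Breaker's
   answer increases the potential by at most the weight that she has removed. *)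
Lemma beck_criterion (I E : finType) (P : pred I) (Y : I -> {set E})
    (goal : {set E} -> Prop) (M B : {set E}) :
  (forall M' : {set E}, M \subset M' -> (forall i, P i -> ~~ [disjoint Y i & M']) -> goal M') ->
  \sum_(i | P i && [disjoint Y i & M]) lam ^- #|Y i :\: B| < 1 ->
  maker_win b goal M B.
Proof.
move=> hit; move: {2}#|~: (M :|: B)| (leqnn #|~: (M :|: B)|) => n.
elim: n M B hit => [|n IH] M B hit nfree pot.
  have full : M :|: B = setT.
    by apply/eqP; rewrite -subTset -setCS setCT subset0 -cards_eq0 -leqn0.
  apply: maker_win_end => //; apply: hit => // i Pi; apply/negP=> dis.
  move: pot; rewrite (bigD1 i) ?Pi //= => pot.
  (* A target that Maker never hit now lies wholly in [B] and has weight 1, against [pot]. *)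
  have : Y i :\: B = set0.
    apply/setP=> e; rewrite !inE; apply/negP=> /andP[eB eY].
    have : e \in M :|: B by rewrite full.
    rewrite inE (negbTE eB) orbF => eM.
    by move/disjoint_setI0/setP/(_ e): dis; rewrite !inE eY eM.
  move=> Y0; move: pot; rewrite Y0 cards0 expr0 invr1; apply/negP; rewrite -leNgt.
  by rewrite lerDl; apply: sumr_ge0 => j _; rewrite invr_ge0 exprn_ge0 ?ltW.
have [full|[e0 e0f]] := set_0Vmem (~: (M :|: B)).
  by apply: IH => //; rewrite full cards0.
pose w i : R := lam ^- #|Y i :\: B|.
have w0 i : 0 <= w i by rewrite invr_ge0 exprn_ge0 ?ltW.
pose bad i := P i && [disjoint Y i & M].
pose g e := \sum_(i | bad i && (e \in Y i)) w i.
have g0 e : 0 <= g e by apply: sumr_ge0.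
case: (@arg_maxP _ _ _ e0 (mem (~: (M :|: B))) g e0f) => e ef emax.
have {}ef : e \in ~: (M :|: B) := ef.
apply: (@maker_win_move _ _ _ _ _ e) => [|A Asub Ab]; first by rewrite -in_setC.
apply: IH => [M' eMM'||].
    by apply: hit; apply: subset_trans eMM'; apply: subsetUr.
  have : e |: ~: (e |: (M :|: B)) = ~: (M :|: B).
    apply/setP=> x; rewrite !inE; case: eqP => // ->.
    by move: ef; rewrite !inE => ->.
  move=> H; move: nfree; rewrite -H cardsU1 !inE eqxx /= add1n ltnS.
  apply: leq_trans; apply: subset_leq_card; rewrite setCS.
  by apply/subsetP=> x; rewrite !inE => /or3P[->|->|->]; rewrite ?orbT.
have Asub' f : f \in A -> [/\ f != e, f \notin M & f \notin B].
  by move/(subsetP Asub); rewrite !inE !negb_or => /and3P[].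
have badE i : P i && [disjoint Y i & e |: M] = bad i && (e \notin Y i).
  rewrite /bad -andbA; congr (_ && _).
  rewrite -setI_eq0 setIUr setU_eq0 !setI_eq0 andbC; congr (_ && _).
  by rewrite disjoint_sym disjoints1.
rewrite (eq_bigl _ _ badE).
have wE i : lam ^- #|Y i :\: (B :|: A)| = w i * lam ^+ #|[set f in A | f \in Y i]|.
  rewrite /w; have -> : #|Y i :\: B| = (#|Y i :\: (B :|: A)| + #|[set f in A | f \in Y i]|)%N.
    rewrite -(cardsID A (Y i :\: B)) addnC setDDl; congr (_ + _)%N.
    apply: eq_card => f; rewrite !inE; case: (boolP (f \in A)) => [/Asub'[_ _ ->]|].
      by rewrite andbT.
    by rewrite andbF.
  by rewrite exprD invfM mulfVK // expf_neq0 // gt_eqF.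
rewrite (eq_bigr _ (fun i _ => wE i)).
apply: le_lt_trans (breaker_gain _ Ab (g0 e) _) _ => // [f fA|].
  have [fe fM fB] := Asub' _ fA.
  have ff : f \in ~: (M :|: B) by rewrite !inE negb_or fM.
  apply: le_trans (emax f ff).
  rewrite [leRHS](bigID (fun i => e \notin Y i)) /=.
  rewrite -[leLHS]addr0; apply: lerD; last exact: sumr_ge0.
  rewrite le_eqVlt; apply/orP; left; apply/eqP/eq_bigl => i.
  by rewrite andbAC.
apply: le_lt_trans pot; rewrite [leRHS](bigID (fun i => e \in Y i)) /=.
by rewrite addrC /g.
Qed.

End Potential.

(** * Perfect matchings in the complete bipartite graph *)

Lemma card_bigcup_le (I T : finType) (N : {set I}) (F : I -> {set T}) :
  #|\bigcup_(j in N) F j| <= \sum_(j in N) #|F j|.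
Proof.
apply: (big_ind2 (fun (X : {set T}) n => #|X| <= n)) => [|X n Y p Xn Yp|//].
  by rewrite cards0.
by rewrite (leq_trans _ (leq_add Xn Yp)) // cardsU leq_subr.
Qed.

Lemma subset_of_card (T : finType) (A C : {set T}) n :
  A \subset C -> #|A| <= n <= #|C| ->
  exists X : {set T}, [/\ A \subset X, X \subset C & #|X| = n].
Proof.
move=> AC /andP[An nC].
pose X := [set x in take (n - #|A|) (enum (C :\: A))].
have XCA : X \subset C :\: A.
  by apply/subsetP=> x; rewrite inE => /mem_take; rewrite mem_enum.
have cX : #|X| = n - #|A|.
  rewrite cardsE; apply/eqP/eqP; rewrite (card_uniqP _); last by rewrite take_uniq ?enum_uniq.
  rewrite size_take -cardE cardsD (setIidPr AC); case: ltnP => //.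
  move=> H; apply/eqP; rewrite eqn_leq H; apply: leq_sub2r nC.
exists (A :|: X); split; first exact: subsetUl.
  by rewrite subUset AC (subset_trans XCA) ?subsetDl.
rewrite cardsU cX; have -> : A :&: X = set0.
  apply/eqP; rewrite setI_eq0 disjoint_sym.
  by apply: disjointWl XCA _; rewrite -setI_eq0 setIDAC setDIl setDv setI0.
by rewrite cards0 subn0 subnKC.
Qed.

Section Bipartite.
Variable m : nat.
Local Notation edges := {set 'I_m * 'I_m}.

(* A vertex is a pair of a side and an index; the first components of edges
   form the side [true]. *)
Definition endpoint (s : bool) (e : 'I_m * 'I_m) : 'I_m := if s then e.1 else e.2.

Definition edge_of (s : bool) (i j : 'I_m) := if s then (i, j) else (j, i).

Definition degree (B : edges) (s : bool) (i : 'I_m) : nat :=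
  #|[set e in B | endpoint s e == i]|.

Definition uncovered (F : edges) (s : bool) : {set 'I_m} :=
  ~: [set endpoint s e | e in F].

Definition is_matching (F : edges) : Prop :=
  forall s, {in F &, injective (endpoint s)}.

(** Maker owns no edge of it exactly when all neighbours of [S] among the uncovered vertices lie in
    [N]; with [#|S| = #|N| + 1] this is a Hall violation. *)
Definition rectangle (F : edges) (s : bool) (S N : {set 'I_m}) : edges :=
  [set e | (endpoint s e \in S) && (endpoint (~~ s) e \in uncovered F (~~ s) :\: N)].

Definition has_perfect_matching (M : edges) : Prop :=
  exists phi : 'S_m, forall i, (i, phi i) \in M.

Lemma endpoint_edge s i j : endpoint s (edge_of s i j) = i.
Proof. by case: s. Qed.

Lemma endpoint_edgeN s i j : endpoint (~~ s) (edge_of s i j) = j.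
Proof. by case: s. Qed.

Lemma edge_endpoint s e : edge_of s (endpoint s e) (endpoint (~~ s) e) = e.
Proof. by case: s; case: e. Qed.

Lemma card_uncovered F s : is_matching F -> #|uncovered F s| = m - #|F|.
Proof. by move=> Fm; rewrite cardsCs setCK card_ord card_in_imset. Qed.

(* If a set [S] of side-[true] vertices has too few neighbours then either [S]
   or the complement of its neighbourhood, taken on the other side, is at most
   half of the graph. *)
Lemma perfect_matching_of_hits (F M : edges) :
  is_matching F -> F \subset M ->
  (forall s (S N : {set 'I_m}),
     S \subset uncovered F s -> N \subset uncovered F (~~ s) ->
     #|S| = #|N|.+1 -> 2 * #|S| <= (m - #|F|).+1 ->
     ~~ [disjoint rectangle F s S N & M]) ->
  has_perfect_matching M.
Proof.
move=> Fm FM hit.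
pose Ut : {set 'I_m} := uncovered F true; pose Uf : {set 'I_m} := uncovered F false.
have cUt : #|Ut| = m - #|F| by apply: card_uncovered.
have cUf : #|Uf| = m - #|F| by apply: card_uncovered.
(* With [L] Hall's condition splits: [F] matches the covered part [S1] of [S] with [N1], which is
   disjoint from [N2], so only [#|S2| <= #|N2|] remains. *)
pose L : edges := F :|: [set e in M | (e.1 \in Ut) && (e.2 \in Uf)].
have LM e : e \in L -> e \in M.
  by rewrite !inE => /orP[/(subsetP FM)|/andP[]].
pose nb (i : 'I_m) : {set 'I_m} := [set j | (i, j) \in L].
case: (@hall_representatives _ _ nb) => [S|phi [phi_inj phiL]]; last first.
  exists (perm phi_inj) => i; rewrite permE; apply: LM.
  by have := phiL i; rewrite inE.
pose S1 : {set 'I_m} := S :\: Ut; pose S2 : {set 'I_m} := S :&: Ut.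
pose N1 : {set 'I_m} := [set e.2 | e in [set e in F | e.1 \in S1]].
pose N2 : {set 'I_m} := [set j in Uf | [exists i in S2, (i, j) \in M]].
have cN1 : #|S1| = #|N1|.
  rewrite /N1 card_in_imset; last first.
    move=> x y; rewrite inE => /andP[xF _]; rewrite inE => /andP[yF _].
    exact: (Fm false).
  suff {1}-> : S1 = [set e.1 | e in [set e in F | e.1 \in S1]].
    rewrite card_in_imset // => x y; rewrite inE => /andP[xF _].
    by rewrite inE => /andP[yF _]; apply: (Fm true).
  apply/setP=> i; apply/idP/imsetP => [iS1|[e]]; last first.
    by rewrite inE => /andP[_ eS] ->.
  have : i \notin Ut by move: iS1; rewrite inE => /andP[].
  rewrite inE negbK => /imsetP[e eF ei]; exists e => //.
  by rewrite inE eF -[e.1]ei iS1.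
have N12 : [disjoint N1 & N2].
  rewrite -setI_eq0; apply/eqP/setP=> j; rewrite in_setI in_set0.
  apply/negP=> /andP[/imsetP[e]]; rewrite inE => /andP[eF _] ->.
  rewrite inE => /andP[+ _]; rewrite inE => /negP; apply.
  by rewrite (imset_f (endpoint false)).
have sub : N1 :|: N2 \subset \bigcup_(i in S) nb i.
  apply/subsetP=> j; rewrite in_setU => /orP[/imsetP[e]|].
    rewrite inE => /andP[eF]; rewrite inE => /andP[_ eS] ->.
    by apply/bigcupP; exists e.1 => //; rewrite !inE -surjective_pairing eF.
  rewrite inE => /andP[jUf /existsP[i /andP[]]]; rewrite inE => /andP[iS iUt] ijM.
  by apply/bigcupP; exists i => //; rewrite inE in_setU in_set /= ijM iUt jUf orbT.
apply: leq_trans (subset_leq_card sub).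
rewrite cardsU (disjoint_setI0 N12) cards0 subn0 -cN1 -(cardsID Ut S) addnC.
rewrite leq_add2l -/S2 leqNgt; apply/negP=> small.
have N2U : N2 \subset Uf by apply/subsetP=> j; rewrite inE => /andP[].
have N2P i j : i \in S2 -> j \in Uf -> (i, j) \in M -> j \in N2.
  by move=> iS jU ij; rewrite inE jU; apply/existsP; exists i; rewrite iS.
have S2U : S2 \subset Ut by apply: subsetIr.
have cS2 := subset_leq_card S2U.
case: (leqP (2 * #|S2|) (m - #|F|).+1) => half.
  case: (@subset_of_card _ N2 Uf #|S2|.-1 N2U) => [|N [N2N NU cN]].
    by move: small cS2; rewrite cUt cUf; lia.
  have cS2N : #|S2| = #|N|.+1 by rewrite cN prednK //; apply: leq_ltn_trans small.
  have /negP := hit true S2 N S2U NU cS2N half; apply.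
  rewrite -setI_eq0; apply/eqP/setP=> -[i j]; rewrite in_setI in_set0.
  apply/negP=> /andP[]; rewrite inE /= in_setD => /andP[iS /andP[jN jU]] ij.
  by move: jN; rewrite (subsetP N2N) // (N2P i).
(* Here [S2] is too large, so the violation is read from the other side: vertices outside [N2] have
   no neighbour in [S2], and [T] consists of one more of them than [Ut :\: S2] has elements. *)
case: (@subset_of_card _ set0 (Uf :\: N2) ((m - #|F|).+1 - #|S2|)) => [||T [_ TU cT]].
- exact: sub0set.
- by rewrite cards0 leq0n /= cardsD (setIidPr N2U) cUf -[leqRHS]subSS; apply: leq_sub2l.
have cN := cardsID S2 Ut; rewrite (setIidPr S2U) in cN.
have cTN : #|T| = #|Ut :\: S2|.+1 by move: small cS2 cN; rewrite cT cUt; lia.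
have halfT : 2 * #|T| <= (m - #|F|).+1 by rewrite cT; move: half cS2; rewrite cUt; lia.
have /negP := hit false T (Ut :\: S2) (subset_trans TU (subsetDl _ _)) (subsetDl _ _) cTN halfT.
apply.
rewrite -setI_eq0; apply/eqP/setP=> -[i j]; rewrite in_setI in_set0.
apply/negP=> /andP[]; rewrite inE /= => /andP[/(subsetP TU)]; rewrite in_setD => /andP[jN jU].
rewrite in_setD in_setD => /andP[+ iU]; rewrite iU andbT negbK => iS ij.
by move: jN; rewrite (N2P i).
Qed.

End Bipartite.

(** * The endgame *)

Section EndGame.
Local Open Scope ring_scope.
Variables (R : realType) (b m q : nat) (lam : R).
Hypothesis lam_gt1 : 1 < lam.
Hypothesis lamXb : lam ^+ b = 2.
(* If [S] has at most [q] vertices and [F] at most [q] edges, each vertex of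
   [S] still sends [13 * q] unclaimed edges to the complement of [N]; larger
   rectangles have at least [5 * q * q] unclaimed edges. *)
Hypothesis lam_vertex : (16 * m)%:R <= lam ^+ (13 * q).
Hypothesis lam_middle : (8 * 4 ^ m)%:R <= lam ^+ (5 * q * q).
Hypothesis q_gt0 : (0 < q)%N.
Hypothesis qm : (16 * q <= m)%N.
Local Notation edges := {set 'I_m * 'I_m}.

Let lam_gt0 : 0 < lam. Proof. exact: lt_trans lam_gt1. Qed.

Definition load_le2 (h : bool -> 'I_m -> option 'I_m) : Prop :=
  forall s j, (#|[set i | h s i == Some j]| <= 2)%N.

(** The preimage of [N] under the neighbours that Maker has given out. *)
Definition trapped (h : bool -> 'I_m -> option 'I_m) s (N : {set 'I_m}) : {set 'I_m} :=
  [set i | if h s i is Some j then j \in N else false].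

Lemma card_trapped h s N : load_le2 h -> (#|trapped h s N| <= 2 * #|N|)%N.
Proof.
move=> h2; have sub : trapped h s N \subset \bigcup_(j in N) [set i | h s i == Some j].
  apply/subsetP=> i; rewrite inE; case hj: (h s i) => [j|] // jN.
  by apply/bigcupP; exists j => //; rewrite inE hj eqxx.
apply: leq_trans (subset_leq_card sub) _; apply: leq_trans (card_bigcup_le _ _) _.
rewrite mulnC -sum_nat_const; apply: leq_sum => j _; exact: h2.
Qed.

Lemma card_rectangle_ge (F B : edges) s (S N : {set 'I_m}) :
  N \subset uncovered F (~~ s) ->
  (forall i, i \in S -> (degree B s i <= q)%N) ->
  (#|S| * (#|uncovered F (~~ s)| - #|N| - q) <= #|rectangle F s S N :\: B|)%N.
Proof.
move=> NU degB; set T := uncovered F (~~ s) :\: N.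
have cT : #|T| = (#|uncovered F (~~ s)| - #|N|)%N by rewrite cardsD (setIidPr NU).
have crect : #|rectangle F s S N| = (#|S| * #|T|)%N.
  rewrite -cardsX -(card_imset (mem (setX S T)) (f := fun u => edge_of s u.1 u.2)).
    apply: eq_card => e; apply/idP/imsetP => [|[[i j]]].
      rewrite inE => H; exists (endpoint s e, endpoint (~~ s) e).
        by rewrite inE.
      by rewrite edge_endpoint.
    by rewrite inE /= => /andP[iS jT] ->; rewrite inE endpoint_edge endpoint_edgeN iS jT.
  move=> [i j] [i' j'] /= eqe; have := congr1 (endpoint s) eqe.
  have := congr1 (endpoint (~~ s)) eqe.
  by rewrite !endpoint_edge !endpoint_edgeN => -> ->.
have crectB : (#|rectangle F s S N :&: B| <= #|S| * q)%N.
  have sub : rectangle F s S N :&: B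
      \subset \bigcup_(i in S) [set e in B | endpoint s e == i].
    apply/subsetP=> e; rewrite !inE => /andP[/andP[eS _] eB].
    by apply/bigcupP; exists (endpoint s e) => //; rewrite !inE eB /=.
  apply: leq_trans (subset_leq_card sub) _; apply: leq_trans (card_bigcup_le _ _) _.
  rewrite -sum_nat_const; apply: leq_sum => i iS; exact: degB.
by rewrite cardsD crect -cT mulnBr; apply: leq_sub2l.
Qed.

Lemma sum_subsets_expr (y : R) :
  \sum_(N : {set 'I_m}) y ^+ #|N| = (1 + y) ^+ m.
Proof.
rewrite addrC -[m in RHS]card_ord -prodr_const (bigA_distr _ _) /=.
by apply: eq_bigr => N _; rewrite -[RHS]big_mkcond /= prodr_const.
Qed.

Lemma expr_small_le2 (y : R) (n : nat) : 0 <= y -> 2 * n%:R * y <= 1 ->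
  (1 + y) ^+ n <= 1 + 2 * n%:R * y.
Proof.
move=> y0; elim: n => [|n IH] ny; first by rewrite expr0 mulr0 mul0r addr0.
have n0 : 0 <= n%:R :> R by [].
rewrite -natr1 in ny *.
have ny' : 2 * n%:R * y <= 1 by nra.
rewrite exprSr; apply: le_trans (_ : (1 + 2 * n%:R * y) * (1 + y) <= _); last nra.
by rewrite ler_wpM2r ?IH // addr_ge0.
Qed.

(** Beck's criterion is applied to the rectangles. One that Maker has not touched has [S] inside
    [trapped h s N], which has at most [2 * #|N|] elements. *)
Lemma endgame (F M B : edges) (h : bool -> 'I_m -> option 'I_m) :
  is_matching F -> F \subset M -> (#|F| <= q)%N -> load_le2 h ->
  (forall s i, i \in uncovered F s -> (degree B s i <= q)%N) ->
  (forall s i, i \in uncovered F s -> exists j,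
     [/\ h s i = Some j, j \in uncovered F (~~ s) & edge_of s i j \in M]) ->
  maker_win b (@has_perfect_matching m) M B.
Proof.
move=> Fm FM Fq h2 degB hM.
pose P (t : bool * ({set 'I_m} * {set 'I_m})) : bool :=
  [&& t.2.1 \subset uncovered F t.1, t.2.2 \subset uncovered F (~~ t.1),
      #|t.2.1| == #|t.2.2|.+1 & (2 * #|t.2.1| <= (m - #|F|).+1)%N].
pose Y (t : bool * ({set 'I_m} * {set 'I_m})) := rectangle F t.1 t.2.1 t.2.2.
have m_gt0 : (0 < m)%N by lia.
have cU s : #|uncovered F s| = (m - #|F|)%N by apply: card_uncovered.
apply: (beck_criterion lam_gt1 lamXb (P := P) (Y := Y)) => [M' MM' hit|].
  apply: (perfect_matching_of_hits Fm (subset_trans FM MM')) => s S N SU NU SN S2.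
  by apply: (hit (s, (S, N))); rewrite /P /= SU NU S2 SN eqxx.
pose kap : R := lam ^- (13 * q); pose eps : R := lam ^- (5 * q * q).
have kap0 : 0 <= kap by rewrite invr_ge0 exprn_ge0 ?ltW.
have eps0 : 0 <= eps by rewrite invr_ge0 exprn_ge0 ?ltW.
pose f (N : {set 'I_m}) : R := kap ^+ #|N|.+1 + eps.
have f0 N : 0 <= f N by rewrite addr_ge0 ?exprn_ge0.
pose G s (S N : {set 'I_m}) : R := if S \subset trapped h s N then f N else 0.
have lamV c d : (d <= c)%N -> lam ^- c <= lam ^- d.
  move=> dc; rewrite lef_pV2 ?posrE ?exprn_gt0 //; apply: ler_weXn2l => //; exact: ltW.
have YG t : P t -> [disjoint Y t & M] -> lam ^- #|Y t :\: B| <= G t.1 t.2.1 t.2.2.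
  case: t => s [S N] /and4P[/= SU NU /eqP SN S2] dis.
  have {}SN : #|S| = #|N|.+1 := SN.
  have {}S2 : (2 * #|S| <= (m - #|F|).+1)%N := S2.
  rewrite /G; have -> : S \subset trapped h s N.
    apply/subsetP=> i iS; have [j [hj jU ijM]] := hM s i (subsetP SU i iS).
    rewrite inE hj; apply/negPn/negP=> jN.
    have eY : edge_of s i j \in Y (s, (S, N)).
      by rewrite inE /= endpoint_edge endpoint_edgeN iS in_setD jN jU.
    by move/disjoint_setI0/setP/(_ (edge_of s i j)): dis; rewrite in_setI eY ijM inE.
  have := @card_rectangle_ge F B s S N NU (fun i iS => degB s i (subsetP SU i iS)).
  rewrite cU => Yge.
  case: (leqP #|S| q) => Sq.
    apply: (@le_trans _ _ (kap ^+ #|N|.+1)); last by rewrite lerDl.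
    have -> : kap ^+ #|N|.+1 = lam ^- (13 * q * #|N|.+1) by rewrite /kap exprVn -exprM.
    apply: lamV; apply: leq_trans Yge.
    by rewrite -SN mulnC leq_mul2l; apply/orP; right; move: SN Sq Fq qm; clear; lia.
  apply: (@le_trans _ _ eps); last by rewrite lerDr exprn_ge0.
  apply: lamV; apply: leq_trans Yge.
  by rewrite -mulnA mulnCA leq_mul; move: SN Sq Fq qm S2; clear; lia.
apply: (@le_lt_trans _ _ (\sum_t G t.1 t.2.1 t.2.2)).
  rewrite big_mkcond; apply: ler_sum => t _; case: ifP => [/andP[]|_]; first exact: YG.
  by rewrite /G; case: ifP.
rewrite -(pair_bigA _ (fun s u => G s u.1 u.2)) /=.
have side_sum s : \sum_u G s u.1 u.2 <= 1 / 4.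
  rewrite -(pair_bigA _ (fun S N => G s S N)) exchange_big /=.
  apply: (@le_trans _ _ (\sum_(N : {set 'I_m}) (kap * (4 * kap) ^+ #|N| + 2 ^+ m * eps))).
    apply: ler_sum => N _; rewrite -big_mkcond /=.
    rewrite (eq_bigl (fun S => S \in powerset (trapped h s N))); last first.
      by move=> S; rewrite powersetE.
    rewrite sumr_const card_powerset -[_ *+ _]mulr_natl /f mulrDr natrX; apply: lerD.
      rewrite exprS mulrCA ler_wpM2l // exprMn ler_wpM2r ?exprn_ge0 //.
      rewrite (_ : 4 = 2 ^+ 2); last by rewrite -natrX.
      by rewrite -exprM; apply: ler_weXn2l; [rewrite ler1n | exact: card_trapped].
    rewrite ler_wpM2r //; apply: ler_weXn2l; first by rewrite ler1n.
    by rewrite -[m in (_ <= m)%N]card_ord max_card.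
  rewrite big_split /= -mulr_sumr sum_subsets_expr sumr_const.
  have m0 : 0 < m%:R :> R by rewrite ltr0n.
  have kapm : 16 * m%:R * kap <= 1.
    by rewrite -natrM -ler_pdivlMr ?invr_gt0 ?exprn_gt0 // invrK mul1r.
  have m1 : 1 <= m%:R :> R by rewrite ler1n.
  have k1 : (1 + 4 * kap) ^+ m <= 2.
    by apply: le_trans (expr_small_le2 _ _) _; nra.
  have kb : kap * (1 + 4 * kap) ^+ m <= 1 / 8 by nra.
  have eb : (2 ^+ m * eps) *+ #|{set 'I_m}| <= 1 / 8.
    rewrite -cardsT -powersetT card_powerset cardsT card_ord -mulr_natl natrX mulrA -exprMn.
    have : (8 * 4 ^ m)%:R * eps <= 1.
      by rewrite -ler_pdivlMr ?invr_gt0 ?exprn_gt0 // invrK mul1r.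
    rewrite natrM natrX => H; have -> : 2 * 2 = 4%:R :> R by rewrite -natrM.
    nra.
  by apply: le_trans (lerD kb eb) _; lra.
apply: le_lt_trans (_ : \sum_(s : bool) (1 / 4 : R) < 1); first exact: ler_sum.
by rewrite big_bool /=; lra.
Qed.

End EndGame.

(** * The opening *)

Section Opening.
Local Open Scope ring_scope.
Variables (R : realType) (b m q : nat) (lam : R).
Hypothesis lam_gt1 : 1 < lam.
Hypothesis lamXb : lam ^+ b = 2.
Hypothesis lam_vertex : (16 * m)%:R <= lam ^+ (13 * q).
Hypothesis lam_middle : (8 * 4 ^ m)%:R <= lam ^+ (5 * q * q).
Hypothesis b_gt0 : (0 < b)%N.
Hypothesis bq : (200 * b <= q)%N.
Hypothesis qm : (16 * q <= m)%N.
Hypothesis mq : (m <= 17 * q)%N.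
Local Notation edges := {set 'I_m * 'I_m}.
Local Notation vertex := (bool * 'I_m)%type.

Let lam_ge1 : 1 <= lam. Proof. exact: ltW. Qed.
Let lam_gt0 : 0 < lam. Proof. exact: lt_trans lam_gt1. Qed.
Let lamX_ge0 n : 0 <= lam ^+ n. Proof. by rewrite exprn_ge0 ?ltW. Qed.

Definition potential (F B : edges) : R :=
  \sum_(v : vertex | v.2 \in uncovered F v.1) lam ^+ degree B v.1 v.2.

(** The given neighbour must still be uncovered, so setting an edge aside can unsettle vertices
    again. *)
Definition settled (F : edges) (h : bool -> 'I_m -> option 'I_m) (v : vertex) : bool :=
  if h v.1 v.2 is Some j then j \in uncovered F (~~ v.1) else false.

Definition unsettled (F : edges) h : {set vertex} :=
  [set v | (v.2 \in uncovered F v.1) && ~~ settled F h v].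

Lemma mem_unsettled F h v :
  (v \in unsettled F h) = (v.2 \in uncovered F v.1) && ~~ settled F h v.
Proof. by rewrite inE. Qed.

(* [t] counts the rounds; [F] is the matching set aside for endangered
   vertices, and [h s i] is a neighbour that Maker has given to [(s, i)]. *)
Record opening_inv (M B F : edges) (h : bool -> 'I_m -> option 'I_m) (t : nat) : Prop := {
  inv_matching : is_matching F;
  inv_sub : F \subset M;
  inv_load : load_le2 h;
  inv_edge : forall s i j, h s i = Some j -> edge_of s i j \in M;
  inv_potential : potential F B <= (4 * m)%:R * lam ^+ q;
  inv_cardM : (#|M| <= t)%N;
  inv_cardB : (#|B| <= b * t)%N;
  inv_heavy : forall e, e \in F ->
    exists s, (q - b <= degree B s (endpoint s e))%N;
  inv_count : (#|unsettled F h| + t <= 2 * m + 5 * #|F|)%N }.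

Lemma sum_degree (B : edges) s : (\sum_i degree B s i = #|B|)%N.
Proof.
rewrite -sum1_card (partition_big (endpoint s) predT) //=.
by apply: eq_bigr => i _; rewrite sum1dep_card.
Qed.

Lemma sum_degree_matching (F B : edges) s :
  is_matching F -> (\sum_(e in F) degree B s (endpoint s e) <= #|B|)%N.
Proof.
move=> Fm; rewrite -(sum_degree B s) -(big_imset (degree B s) (Fm s)) /=.
by rewrite [leqRHS](bigID (mem [set endpoint s e | e in F])) leq_addr.
Qed.

(** Each edge of the matching [F] has an end of degree at least [q - b] in [B], so
    [#|F| * (q - b) <= 2 * b * t]. Together with [t <= 2 * m + 5 * #|F|] and [200 * b <= q] this
    bounds both quantities. *)
Lemma inv_card_bound M B F h t : opening_inv M B F h t -> (2 * #|F| <= q)%N /\ (t <= 3 * m)%N.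
Proof.
case=> Fm _ _ _ _ _ cB heavy cnt.
have H : (#|F| * (q - b) <= 2 * (b * t))%N.
  apply: (@leq_trans (\sum_(e in F) (degree B true (endpoint true e) + degree B false (endpoint false e)))).
    rewrite -sum_nat_const; apply: leq_sum => e /heavy[[]] He; apply: (leq_trans He).
      exact: leq_addr.
    exact: leq_addl.
  rewrite big_split mul2n -addnn; apply: leq_add; apply: leq_trans cB; exact: sum_degree_matching.
move: H cnt bq qm mq; move: #|F| #|unsettled F h| => x u.
clear -b_gt0 => H cnt bq qm mq.
have t_le : (t <= 34 * q + 5 * x)%N by lia.
(* The term [5 * x] in the bound on [t] costs [10 * b * x], which is moved to the left:
   [11 = 1 + 10]. *)
have H1 : (x * (q - 11 * b) <= 68 * b * q)%N.
  have E : (x * (q - b) = x * (q - 11 * b) + x * (10 * b))%N.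
    by rewrite -mulnDr; congr (_ * _)%N; lia.
  have := leq_trans H (leq_mul (leqnn 2) (leq_mul (leqnn b) t_le)).
  by rewrite E; lia.
have x_le : (2 * x <= q)%N.
  rewrite leqNgt; apply/negP => qx.
  have : (q * (q - 11 * b) <= q * (136 * b))%N.
    by have := leq_mul (ltnW qx) (leqnn (q - 11 * b)); lia.
  by rewrite leq_mul2l; lia.
by split=> //; lia.
Qed.

Lemma degree_setU (A B : edges) s i : [disjoint A & B] ->
  degree (B :|: A) s i = (degree B s i + #|[set f in A | endpoint s f == i]|)%N.
Proof.
move=> AB; rewrite /degree -cardsUI.
have -> : [set e in B | endpoint s e == i] :&: [set f in A | endpoint s f == i] = set0.
  apply/setP=> e; rewrite !inE; apply/negP=> /andP[/andP[eB _] /andP[eA _]].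
  by move/disjoint_setI0/setP/(_ e): AB; rewrite !inE eA eB.
rewrite cards0 addn0; apply: eq_card => e; rewrite !inE.
by rewrite andb_orl.
Qed.

Lemma degreeS (A B : edges) s i : A \subset B -> (degree A s i <= degree B s i)%N.
Proof.
move=> AB; apply: subset_leq_card; apply/subsetP=> e; rewrite !inE.
by case/andP=> /(subsetP AB)-> ->.
Qed.

Lemma exists_free_neighbour (B : edges) s i (Z : {set 'I_m}) :
  (degree B s i < #|Z|)%N -> exists2 j, j \in Z & edge_of s i j \notin B.
Proof.
move=> dZ; apply/exists_inP; apply: contraLR dZ; rewrite negb_exists_in -leqNgt => /forall_inP ZB.
have inj : injective (edge_of s i) by move=> j j' /(congr1 (endpoint (~~ s))); rewrite !endpoint_edgeN.
rewrite -(card_imset (mem Z) inj); apply: subset_leq_card; apply/subsetP=> e /imsetP[j jZ ->].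
by rewrite inE endpoint_edge eqxx andbT; have := ZB _ jZ; rewrite negbK.
Qed.

(** An edge that Maker already owns qualifies: when she sets it aside, her claim in that round is an
    arbitrary free edge. *)
Definition candidates (F B : edges) : edges :=
  [set e | [&& e \notin B, endpoint true e \in uncovered F true
             & endpoint false e \in uncovered F false]].

Lemma mem_candidates F B s i j :
  (edge_of s i j \in candidates F B) =
  [&& edge_of s i j \notin B, i \in uncovered F s & j \in uncovered F (~~ s)].
Proof. by rewrite inE; case: s => //=; rewrite [X in _ && X]andbC. Qed.

(** A vertex of degree [14 * q] would alone contribute [lam ^ (13 * q) * lam ^ q >= 16 * m * lam ^
    q], more than the whole potential. *)
Lemma degree_bound M B F h t s i : opening_inv M B F h t ->
  i \in uncovered F s -> (degree B s i < 14 * q)%N.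
Proof.
move=> inv iU; rewrite ltnNge; apply/negP=> deg.
have m_gt0 : (0 < m)%N by apply: leq_trans qm; lia.
have := inv_potential inv; rewrite /potential (bigD1 (s, i)) //=; apply/negP; rewrite -ltNge.
apply: (@lt_le_trans _ _ ((16 * m)%:R * lam ^+ q)).
  by rewrite ltr_pM2r ?exprn_gt0 // ltr_nat ltn_mul2r m_gt0.
apply: (@le_trans _ _ (lam ^+ (14 * q))).
  have -> : (14 * q = 13 * q + q)%N by lia.
  by rewrite exprD ler_wpM2r.
apply: (@le_trans _ _ (lam ^+ degree B s i)); first exact: ler_weXn2l.
by rewrite lerDl; apply: sumr_ge0.
Qed.

Lemma exists_candidate M B F h t s i : opening_inv M B F h t ->
  i \in uncovered F s -> exists j, edge_of s i j \in candidates F B.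
Proof.
move=> inv iU; have dB := degree_bound inv iU.
have [Fq _] := inv_card_bound inv.
case: (@exists_free_neighbour B s i (uncovered F (~~ s))) => [|j jU jB].
  rewrite card_uncovered; last exact: inv_matching inv.
  by move: dB Fq qm; clear; lia.
by exists j; rewrite mem_candidates jB iU.
Qed.

(** At most [(b + 1) * 3 * m] edges have been claimed, fewer than [m * m]. *)
Lemma exists_free_edge M B F h t : opening_inv M B F h t ->
  exists e, e \notin M :|: B.
Proof.
move=> inv; have [_ t_le] := inv_card_bound inv.
suff : (#|M :|: B| < #|{: 'I_m * 'I_m}|)%N.
  rewrite -cardsT => lt; case: (set_0Vmem (~: (M :|: B))) => [full|[e]].
    have MB : M :|: B = setT by rewrite -[LHS]setCK full setC0.
    by move: lt; rewrite MB ltnn.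
  by rewrite in_setC; exists e.
rewrite card_prod card_ord; apply: (@leq_ltn_trans (t + b * t)).
  by rewrite (leq_trans (leq_card_setU _ _)) // leq_add ?(inv_cardM inv) ?(inv_cardB inv).
by move: t_le bq qm b_gt0; clear; nia.
Qed.

Let candidate_weight (B : edges) e : R :=
  lam ^+ degree B true (endpoint true e) + lam ^+ degree B false (endpoint false e).

Let candidate_weightE B s e :
  candidate_weight B e = lam ^+ degree B s (endpoint s e)
    + lam ^+ degree B (~~ s) (endpoint (~~ s) e).
Proof. by case: s => //=; rewrite addrC. Qed.

Lemma uncoveredU1 (F : edges) e s : uncovered (e |: F) s = uncovered F s :\ endpoint s e.
Proof. by rewrite /uncovered imsetU1 setCU setIC setDE. Qed.

Lemma sum_incident (F B : edges) f :
  \sum_(v : vertex | (v.2 \in uncovered F v.1) && (endpoint v.1 f == v.2))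
      lam ^+ degree B v.1 v.2
  = \sum_(s : bool | endpoint s f \in uncovered F s) lam ^+ degree B s (endpoint s f).
Proof.
pose G s i := if (i \in uncovered F s) && (endpoint s f == i) then lam ^+ degree B s i else 0.
rewrite big_mkcond -(pair_bigA _ G) [RHS]big_mkcond; apply: eq_bigr => s _.
rewrite (bigD1 (endpoint s f)) //= {1}/G eqxx andbT big1 ?addr0 // => i ne.
by rewrite /G eq_sym (negbTE ne) andbF.
Qed.

(* An edge claimed by Breaker between uncovered vertices was itself a candidate;
   otherwise its uncovered end, if any, lies on some candidate. *)
Lemma potential_freeze M B F h t e (A : edges) : opening_inv M B F h t ->
  e \in candidates F B ->
  (forall f, f \in candidates F B -> candidate_weight B f <= candidate_weight B e) ->
  [disjoint A & B] -> (#|A| <= b)%N ->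
  potential (e |: F) (B :|: A) <= potential F B.
Proof.
move=> inv ec emax AB Ab.
pose P (v : vertex) := v.2 \in uncovered (e |: F) v.1.
pose w (v : vertex) := lam ^+ degree B v.1 v.2.
have g0 : 0 <= candidate_weight B e by rewrite addr_ge0.
rewrite /potential (eq_bigr (fun v => w v * lam ^+ #|[set f in A | endpoint v.1 f == v.2]|)); last first.
  by move=> v _; rewrite degree_setU // exprD.
apply: (@le_trans _ _ (\sum_(v | P v) w v + candidate_weight B e)).
  apply: (breaker_gain lam_gt1 lamXb (P := P) (inc := fun v f => endpoint v.1 f == v.2)) => // [v _|f fA]; first exact: lamX_ge0.
  have fB : f \notin B.
    by apply/negP=> fB; move/disjoint_setI0/setP/(_ f): AB; rewrite !inE fA fB.
  rewrite sum_incident big_mkcond big_bool /=.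
  have one s : endpoint s f \in uncovered (e |: F) s ->
      lam ^+ degree B s (endpoint s f) <= candidate_weight B e.
    rewrite uncoveredU1 => /setD1P[_ fU]; have [j jc] := exists_candidate inv fU.
    apply: le_trans (emax _ jc); rewrite (candidate_weightE B s) endpoint_edge.
    by rewrite lerDl.
  have := one true; have := one false.
  case: ifP => [tU|_]; case: ifP => [fU|_] => H1 H2.
  - apply: (emax f); move: tU fU; rewrite !uncoveredU1 !in_setD1 => /andP[_ tU] /andP[_ fU].
    by rewrite inE fB tU fU.
  - by rewrite addr0 H2.
  - by rewrite add0r H1.
  - by rewrite addr0.
have [eB eT eF] : [/\ e \notin B, endpoint true e \in uncovered F true
    & endpoint false e \in uncovered F false] by apply/and3P; move: ec; rewrite inE.
(* Covering the two ends of [e] removes exactly its weight, which pays for Breaker's gain. *)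
have tot : \sum_(v : vertex | v.2 \in uncovered F v.1) w v =
    \sum_(v : vertex | (v.2 \in uncovered F v.1) && (endpoint v.1 e == v.2)) w v
    + \sum_(v | P v) w v.
  rewrite (bigID (fun v : vertex => endpoint v.1 e == v.2)) /=; congr (_ + _).
  by apply: eq_bigl => v; rewrite /P uncoveredU1 in_setD1 andbC eq_sym.
by rewrite tot sum_incident addrC lerD2r big_mkcond big_bool /= eT eF.
Qed.

(** After Breaker's answer all degrees are at most [q + b], and [lam ^ b = 2] turns [2 * m] vertices
    into the factor [4 * m]. The previous potential does not enter, so every calm round resets the
    bound. *)
Lemma potential_calm (F B A : edges) :
  (forall s i, i \in uncovered F s -> (degree B s i <= q)%N) ->
  [disjoint A & B] -> (#|A| <= b)%N ->
  potential F (B :|: A) <= (4 * m)%:R * lam ^+ q.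
Proof.
move=> calm AB Ab.
apply: (@le_trans _ _ (\sum_(v : vertex) lam ^+ (q + b))).
  rewrite /potential big_mkcond; apply: ler_sum => v _; case: ifP => // vU.
  apply: ler_weXn2l => //; rewrite degree_setU //; apply: leq_add; first exact: calm.
  by apply: leq_trans Ab; apply: subset_leq_card; apply/subsetP=> f; rewrite inE => /andP[].
rewrite sumr_const card_prod card_bool card_ord exprD lamXb -[_ *+ _]mulr_natl.
have -> : (4 * m)%:R * lam ^+ q = (2 * m)%:R * (lam ^+ q * 2) :> R.
  by rewrite (natrM R 4) (natrM R 2); ring.
exact: lexx.
Qed.

(** Each of the two newly covered vertices was given to at most two others, so at most four vertices
    become unsettled; with the round itself this is the 5 in [inv_count]. *)
Lemma opening_freeze M B F h t e e1 (A : edges) : opening_inv M B F h t ->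
  e \in candidates F B ->
  (forall f, f \in candidates F B -> candidate_weight B f <= candidate_weight B e) ->
  lam ^+ q <= candidate_weight B e ->
  e \in e1 |: M -> [disjoint A & B] -> (#|A| <= b)%N ->
  opening_inv (e1 |: M) (B :|: A) (e |: F) h t.+1.
Proof.
move=> inv ec emax we eM AB Ab.
have eU s : endpoint s e \in uncovered F s.
  by move: ec; rewrite inE => /and3P[_]; case: s.
have eF : e \notin F.
  by apply/negP=> eF; have := eU true; rewrite inE imset_f.
constructor.
- move=> s x y /setU1P[->|xF] /setU1P[->|yF] //.
  + by move=> xy; have := eU s; rewrite inE xy imset_f.
  + by move=> xy; have := eU s; rewrite inE -xy imset_f.
  + exact: (inv_matching inv xF yF).
- by rewrite subUset sub1set eM (subset_trans (inv_sub inv)) ?subsetUr.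
- exact: inv_load inv.
- by move=> s i j /(inv_edge inv); rewrite in_setU1 => ->; rewrite orbT.
- by apply: le_trans (inv_potential inv); apply: potential_freeze inv ec emax AB Ab.
- rewrite cardsU1; apply: leq_trans (leq_add (leq_b1 _) (inv_cardM inv)) _; exact: leqnn.
- by rewrite mulnS addnC (leq_trans (leq_card_setU _ _)) // leq_add // (inv_cardB inv).
- move=> f /setU1P[->|/(inv_heavy inv)[s Hs]]; last first.
    by exists s; apply: leq_trans Hs (degreeS _ _ (subsetUl _ _)).
  suff [s Hs] : exists s, (q - b <= degree B s (endpoint s e))%N.
    by exists s; apply: leq_trans Hs (degreeS _ _ (subsetUl _ _)).
  case: (leqP (q - b) (degree B true (endpoint true e))) => dT; first by exists true.
  case: (leqP (q - b) (degree B false (endpoint false e))) => dF; first by exists false.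
  (* Two ends of degree below [q - b] weigh at most [2 * lam ^ (q - b - 1)], which is less than
     [2 * lam ^ (q - b) = lam ^ q]. *)
  have qb : (q = (q - b).-1 + b.+1)%N by move: dT bq; clear; lia.
  move: we; rewrite {1}qb exprD exprS lamXb.
  have X0 : 0 < lam ^+ (q - b).-1 by rewrite exprn_gt0.
  have HT : lam ^+ degree B true (endpoint true e) <= lam ^+ (q - b).-1.
    by apply: ler_weXn2l => //; move: dT; clear; lia.
  have HF : lam ^+ degree B false (endpoint false e) <= lam ^+ (q - b).-1.
    by apply: ler_weXn2l => //; move: dF; clear; lia.
  move=> we'; exfalso; have := le_trans we' (lerD HT HF).
  move: (lam ^+ (q - b).-1) X0 => X X0.
  apply/negP; rewrite -ltNge -mulr2n -[X *+ 2]mulr_natr ltr_pM2l //.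
  by rewrite -[ltLHS]mul1r ltr_pM2r.
- rewrite cardsU1 eF add1n.
  have sub : unsettled (e |: F) h \subset unsettled F h :|:
      \bigcup_(s in [set: bool]) [set (s, i) | i in [set i | h s i == Some (endpoint (~~ s) e)]].
    apply/subsetP=> -[s i]; rewrite in_setU !mem_unsettled /= uncoveredU1 in_setD1.
    case/andP=> /andP[ie iU]; rewrite iU /= /settled /=.
    case hj: (h s i) => [j|] //=; rewrite uncoveredU1 in_setD1 negb_and negbK.
    case/orP=> [/eqP je|->//]; apply/orP; right; apply/bigcupP; exists s => //.
    by apply: imset_f; rewrite inE hj je.
  have c4 : (#|\bigcup_(s in [set: bool]) [set (s, i) | i in [set i | h s i == Some (endpoint (~~ s) e)]]| <= 4)%N.
    apply: leq_trans (card_bigcup_le _ _) _; rewrite (eq_bigl predT); last by move=> s; rewrite inE.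
    rewrite big_bool /= (_ : 4 = 2 + 2)%N //; apply: leq_add; apply: leq_trans (leq_imset_card _ _) _;
      exact: inv_load inv _ _.
  have H : (#|unsettled (e |: F) h| <= #|unsettled F h| + 4)%N.
    apply: leq_trans (subset_leq_card sub) _; apply: leq_trans (leq_card_setU _ _) _.
    by rewrite leq_add2l.
  have := inv_count inv; move: H; clear; lia.
Qed.

(** The vertex [v] leaves the unsettled set while [t] grows by one, which preserves [inv_count]. *)
Lemma opening_settle M B F h t v j e1 (A : edges) : opening_inv M B F h t ->
  (forall s i, i \in uncovered F s -> (degree B s i <= q)%N) ->
  v \in unsettled F h -> j \in uncovered F (~~ v.1) ->
  (#|[set i | h v.1 i == Some j]| < 2)%N ->
  edge_of v.1 v.2 j \in e1 |: M -> [disjoint A & B] -> (#|A| <= b)%N ->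
  opening_inv (e1 |: M) (B :|: A) F
    (fun s i => if (s, i) == v then Some j else h s i) t.+1.
Proof.
move=> inv calm vu jU jload jM AB Ab; constructor.
- exact: inv_matching inv.
- by rewrite (subset_trans (inv_sub inv)) ?subsetUr.
- move=> s j'; case: (boolP ((s == v.1) && (j' == j))) => [/andP[/eqP-> /eqP->]|ne].
    apply: (@leq_trans #|v.2 |: [set i | h v.1 i == Some j]|).
      apply: subset_leq_card; apply/subsetP=> i; rewrite !inE.
      by case: v {vu jU jload jM} => s0 i0 /=; rewrite xpair_eqE eqxx /=; case: (i == i0).
    by rewrite cardsU1; move: jload; clear; case: (_ \notin _); lia.
  apply: leq_trans (inv_load inv s j'); apply: subset_leq_card; apply/subsetP=> i.
  rewrite !inE; case: ifP => // /eqP sv; move: ne; rewrite -sv /= eqxx /= => ne.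
  by case/eqP=> jj; rewrite jj eqxx in ne.
- move=> s i j'; case: ifP => [/eqP sv [<-]|_ /(inv_edge inv)]; first by move: jM; rewrite -sv.
  by rewrite in_setU1 => ->; rewrite orbT.
- exact: potential_calm.
- rewrite cardsU1; apply: leq_trans (leq_add (leq_b1 _) (inv_cardM inv)) _; exact: leqnn.
- by rewrite mulnS addnC (leq_trans (leq_card_setU _ _)) // leq_add // (inv_cardB inv).
- move=> f /(inv_heavy inv)[s Hs].
  by exists s; apply: leq_trans Hs (degreeS _ _ (subsetUl _ _)).
- set h' := fun s i => _.
  have sub : unsettled F h' \subset unsettled F h :\ v.
    apply/subsetP=> -[s i]; rewrite in_setD1 !mem_unsettled /= /settled /h' /=.
    case: ifP => [/eqP sv|//]; rewrite -sv in jU; rewrite jU andbF //.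
  have := subset_leq_card sub; have := inv_count inv; rewrite (cardsD1 v) vu; clear; lia.
Qed.

(** The induction is on the rounds left, as [t <= 3 * m]. Maker sets an edge aside if a vertex is
    endangered, otherwise settles an unsettled vertex, and enters the endgame once none is left. *)
Lemma opening_win M B F h t : opening_inv M B F h t ->
  maker_win b (@has_perfect_matching m) M B.
Proof.
move: {2}(3 * m + 1 - t)%N (leqnn (3 * m + 1 - t)%N) => n.
elim: n M B F h t => [|n IH] M B F h t nt inv.
  by have [_ t_le] := inv_card_bound inv; move: nt t_le; clear; lia.
have {}IH M' B' F' h' : opening_inv M' B' F' h' t.+1 ->
    maker_win b (@has_perfect_matching m) M' B'.
  by apply: IH; move: nt; clear; lia.
have [e0 e0f] := exists_free_edge inv.
have [Fq _] := inv_card_bound inv.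
have Fm := inv_matching inv.
have claim e : e \notin B -> exists2 e1, e1 \notin M :|: B & e \in e1 |: M.
  move=> eB; case: (boolP (e \in M)) => eM.
    by exists e0 => //; rewrite in_setU1 eM orbT.
  by exists e; rewrite ?setU11 // in_setU negb_or eM.
have disj e1 (A : edges) : A \subset ~: (e1 |: (M :|: B)) -> [disjoint A & B].
  move=> AE; rewrite disjoint_sym disjoints_subset -setCS setCK; apply: subset_trans AE _.
  by rewrite setCS setUA subsetUr.
have [|calm] := boolP [exists v : vertex, (v.2 \in uncovered F v.1) && (q <= degree B v.1 v.2)%N].
  case/existsP=> -[s i] /= /andP[iU deg]; have [j jc] := exists_candidate inv iU.
  case: (@arg_maxP _ _ _ _ (mem (candidates F B)) (candidate_weight B) jc) => e ec' emax.
  have {ec'}ec : e \in candidates F B := ec'.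
  have eB : e \notin B by move: ec; rewrite inE => /andP[].
  have [e1 e1f eM] := claim e eB; apply: (maker_win_move e1f) => A AE Ab; apply: IH.
  apply: (opening_freeze inv ec emax) => //; last exact: disj AE.
  apply: le_trans (emax _ jc); rewrite (candidate_weightE B s) endpoint_edge.
  by apply: ler_wpDr => //; apply: ler_weXn2l.
have {}calm s i : i \in uncovered F s -> (degree B s i <= q)%N.
  move=> iU; move: calm; rewrite negb_exists => /forallP/(_ (s, i)).
  by rewrite /= iU /= -ltnNge => /ltnW.
have [all_settled|[v vu]] := set_0Vmem (unsettled F h).
  have q_gt0 : (0 < q)%N by move: bq b_gt0; clear; lia.
  apply: (endgame lam_gt1 lamXb lam_vertex lam_middle q_gt0 qm Fm (inv_sub inv) _ (inv_load inv) calm).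
    by move: Fq; clear; lia.
  move=> s i iU; have : (s, i) \notin unsettled F h by rewrite all_settled inE.
  rewrite mem_unsettled /= iU /= negbK /settled /=; case hj: (h s i) => [j|] // jU.
  by exists j; split=> //; apply: inv_edge inv _ _ _ hj.
(* These vertices have reached their load. Double counting leaves at least [m / 2 - q / 2]
   admissible neighbours, more than the at most [q] edges that Breaker has at [v]. *)
pose heavy : {set 'I_m} := [set j | (2 <= #|[set i | h v.1 i == Some j]|)%N].
have heavy_card : (2 * #|heavy| <= m)%N.
  apply: (@leq_trans (\sum_(j in heavy) #|[set i | h v.1 i == Some j]|)%N).
    by rewrite mulnC -sum_nat_const; apply: leq_sum => j; rewrite inE.
  rewrite -[leqRHS]card_ord -sum1_card.
  rewrite (eq_bigr (fun j => \sum_(i | h v.1 i == Some j) 1)%N); last first.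
    by move=> j _; rewrite sum1dep_card.
  rewrite (exchange_big_dep predT) //=; apply: leq_sum => i _.
  rewrite sum1dep_card; apply/card_le1_eqP => j j'.
  by rewrite !inE => /andP[_ /eqP->] /andP[_ /eqP[->]].
have vU : v.2 \in uncovered F v.1 by move: vu; rewrite mem_unsettled => /andP[].
case: (@exists_free_neighbour B v.1 v.2 (uncovered F (~~ v.1) :\: heavy)) => [|j].
  apply: leq_ltn_trans (calm _ _ vU) _; set Z := _ :\: heavy.
  have H : (m - #|F| <= #|Z| + #|heavy|)%N.
    apply: leq_trans (leq_card_setU Z heavy).
    rewrite -(card_uncovered (~~ v.1) Fm); apply: subset_leq_card.
    by apply/subsetP=> j jU; rewrite in_setU in_setD jU andbT orNb.
  by move: H heavy_card Fq qm bq b_gt0; move: #|Z| #|heavy| #|F|; clear; lia.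
rewrite in_setD inE -ltnNge => /andP[jload jU] jB.
have [e1 e1f eM] := claim _ jB; apply: (maker_win_move e1f) => A AE Ab; apply: IH.
exact: (opening_settle inv calm vu jU jload eM (disj _ _ AE) Ab).
Qed.

Lemma opening_inv0 : (0 < m)%N -> opening_inv set0 set0 set0 (fun _ _ => None) 0.
Proof.
move=> m_gt0; constructor.
- by move=> s x y; rewrite inE.
- exact: sub0set.
- by move=> s j; rewrite (eq_card0) // => i; rewrite inE.
- by [].
- have : @potential set0 set0 <= \sum_(v : vertex) 1.
    rewrite /potential big_mkcond; apply: ler_sum => v _; case: ifP => // _.
    by rewrite /degree (eq_card0 (A := [set _ | _])) ?expr0 // => e; rewrite !inE.
  move/le_trans; apply; rewrite sumr_const card_prod card_bool card_ord.
  have : 1 <= lam ^+ q by apply: exprn_ege1.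
  have : (2 * m)%:R <= (4 * m)%:R :> R by rewrite ler_nat leq_mul2r orbT.
  have : 0 <= (2 * m)%:R :> R by [].
  move: (2 * m)%:R (4 * m)%:R (lam ^+ q) => x y z x0 xy z1; nra.
- by rewrite cards0.
- by rewrite cards0.
- by move=> e; rewrite inE.
- rewrite cards0 addn0 muln0 addn0; apply: leq_trans (max_card _) _.
  by rewrite card_prod card_bool card_ord.
Qed.

End Opening.

(** * The perfect matching game *)

Section MatchingGame.
Local Open Scope ring_scope.

(** With [lam ^ b = 2], the last hypothesis says [m ^ 4 <= lam ^ (3 * m)]. *)
Lemma matching_game (R : realType) (b m c : nat) :
  (0 < b)%N -> (3000 <= c)%N -> (2 ^ c <= m)%N -> (m ^ (4 * b) <= 2 ^ (3 * m))%N ->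
  maker_win b (@has_perfect_matching m) set0 set0.
Proof.
move=> b_gt0 c_ge m_ge mb.
have m_c : (3000 <= m)%N by apply: leq_trans m_ge; apply: leq_trans c_ge (ltnW (ltn_expl _ _)).
have b_small : (c * (4 * b) <= 3 * m)%N.
  rewrite -(@leq_exp2l 2) //; apply: leq_trans mb.
  by rewrite expnM leq_exp2r // muln_gt0.
pose q := (m %/ 16)%N.
have qm : (16 * q <= m)%N by rewrite /q; move: (leq_trunc_div m 16); lia.
have qm' : (m < 16 * q + 16)%N by rewrite /q; move: (ltn_ceil m (isT : (0 < 16)%N)); lia.
have q_ge : (187 <= q)%N by move: m_c qm'; clear; lia.
have mq : (m <= 17 * q)%N by move: q_ge qm'; clear; lia.
have bq : (200 * b <= q)%N.
  have : (3000 * (4 * b) <= 3 * m)%N by apply: leq_trans b_small; rewrite leq_mul2r c_ge orbT.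
  by move: mq; clear; lia.
have b0 : 0 < b%:R :> R by rewrite ltr0n.
pose lam : R := sequences.expR (ln 2 / b%:R).
have lam_gt1 : 1 < lam by rewrite expR_gt1 divr_gt0 // ln_gt0 // ltr1n.
have lamXb : lam ^+ b = 2.
  by rewrite -expRM_natl mulrCA divff ?mulr1 ?gt_eqF // lnK // posrE.
have lam_gt0 : 0 < lam by exact: lt_trans lam_gt1.
have lam_ge1 : 1 <= lam by exact: ltW.
have lamX_ge0 n : 0 <= lam ^+ n by rewrite exprn_ge0 ?ltW.
have lam3m : m%:R ^+ 4 <= lam ^+ (3 * m).
  rewrite -(@ler_pXn2r _ b) ?nnegrE ?lamX_ge0 ?exprn_ge0 // -[leLHS]exprM -[leRHS]exprM.
  by rewrite [(3 * m * b)%N]mulnC [leRHS]exprM lamXb -!natrX ler_nat.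
have m2c : 2 ^+ c <= m%:R :> R by rewrite -natrX ler_nat.
have lam_vertex : (16 * m)%:R <= lam ^+ (13 * q).
  (* As [q] is about [m / 16], [13 * 96 * q >= 75 * m], and [lam ^ (75 * m) >= m ^ 100]. The surplus
     [m ^ 4] over [m ^ 96] absorbs [16 ^ 96]. *)
  rewrite -(@ler_pXn2r _ 96) ?nnegrE // -exprM.
  apply: (@le_trans _ _ (lam ^+ (3 * m * 25))); last first.
    by apply: ler_weXn2l => //; move: qm' q_ge; clear; lia.
  rewrite exprM; apply: le_trans (_ : (m%:R ^+ 4) ^+ 25 <= _); last first.
    by rewrite ler_pXn2r ?nnegrE ?lamX_ge0 ?exprn_ge0.
  rewrite natrM exprMn -exprM (_ : (4 * 25 = 4 + 96)%N) // exprD ler_wpM2r ?exprn_ge0 //.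
  apply: le_trans (_ : (2 ^+ c) ^+ 4 <= _); last by rewrite ler_pXn2r ?nnegrE ?lamX_ge0 ?exprn_ge0.
  rewrite (_ : 16 = 2 ^+ 4); last by rewrite -natrX.
  rewrite -!exprM; apply: ler_weXn2l; first by rewrite ler1n.
  by move: c_ge; clear; lia.
have lam_middle : (8 * 4 ^ m)%:R <= lam ^+ (5 * q * q).
  (* The exponent 37 suffices because [8 * 4 ^ m = 2 ^ (3 + 2 * m)] and
     [3 + 2 * m <= 3 + 34 * q <= 37 * q]. *)
  have H : 2 ^+ 37 <= lam ^+ (5 * q).
    rewrite -(@ler_pXn2r _ 11) ?nnegrE ?lamX_ge0 ?exprn_ge0 // -[leRHS]exprM.
    apply: (@le_trans _ _ (lam ^+ (3 * m))); last first.
      by apply: ler_weXn2l => //; move: mq; clear; lia.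
    apply: le_trans lam3m; apply: le_trans (_ : (2 ^+ c) ^+ 4 <= _); last by rewrite ler_pXn2r ?nnegrE ?lamX_ge0 ?exprn_ge0.
    rewrite -!exprM; apply: ler_weXn2l; first by rewrite ler1n.
    by move: c_ge; clear; lia.
  rewrite exprM; apply: le_trans (_ : (2 ^+ 37) ^+ q <= _); last by rewrite ler_pXn2r ?nnegrE ?lamX_ge0 ?exprn_ge0 //; move: q_ge; clear; lia.
  rewrite (_ : (8 * 4 ^ m = 2 ^ (3 + 2 * m))%N); last by rewrite expnD expnM.
  rewrite natrX -exprM; apply: ler_weXn2l; first by rewrite ler1n.
  by move: mq q_ge; clear; lia.
have m_gt0 : (0 < m)%N by move: m_c; clear; lia.
exact: (opening_win lam_gt1 lamXb lam_vertex lam_middle b_gt0 bq qm mq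
  (opening_inv0 b q lam_gt1 m_gt0)).
Qed.

(** This follows from [1 / 2 <= (17 / 18) ^ 12] and [ln (17 / 18) <= - 1 / 18]. *)
Lemma ln2_ge (R : realType) : 2 / 3 <= ln 2 :> R.
Proof.
have H : ln ((17 / 18) ^+ 12 : R) <= - (2 / 3).
  rewrite lnXn; last lra.
  have := @le_ln1Dx R (- (1 / 18)) _.
  rewrite (_ : 1 + - (1 / 18) = 17 / 18 :> R); last lra.
  by rewrite -[_ *+ 12]mulr_natl => H; have {}H := H ltac:(lra); lra.
have : - ln (2 : R) <= ln ((17 / 18) ^+ 12 : R).
  rewrite -lnV ?posrE // ler_ln ?posrE ?invr_gt0 ?exprn_gt0 //; lra.
lra.
Qed.

(** Since [n <= m * k], the bias satisfies [2 * b * ln n <= m]; hence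
    [4 * b * ln m <= 2 * m <= 3 * m * ln 2]. *)
Lemma bias_bound (R : realType) (n m b k d : nat) :
  (1 < n)%N -> n = (m * d)%N -> (0 < d)%N -> (d <= k)%N -> (0 < k)%N ->
  b%:R <= n%:R / (2 * k%:R * ln n%:R) :> R ->
  (m ^ (4 * b) <= 2 ^ (3 * m))%N.
Proof.
move=> n1 nmd d0 dk k0 hb.
have m0 : (0 < m)%N by case: m nmd n1 => //; rewrite mul0n => ->.
have mn : (m <= n)%N by rewrite nmd leq_pmulr.
have ln_n : 0 < ln n%:R :> R by rewrite ln_gt0 // ltr1n.
have kR : 0 < k%:R :> R by rewrite ltr0n.
have mR : 0 < m%:R :> R by rewrite ltr0n.
have hb' : 2 * b%:R * ln n%:R <= m%:R :> R.
  have : b%:R * (2 * k%:R * ln n%:R) <= n%:R :> R.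
    by rewrite -ler_pdivlMr // mulr_gt0 // mulr_gt0.
  have nR : n%:R <= m%:R * k%:R :> R by rewrite -natrM ler_nat nmd leq_mul2l dk orbT.
  move=> H; rewrite -(ler_pM2r kR); apply: le_trans nR; apply: le_trans H.
  by rewrite le_eqVlt; apply/orP; left; apply/eqP; ring.
rewrite -(ler_nat R) !natrX -ler_ln ?posrE ?exprn_gt0 // !lnXn //.
have lm : ln m%:R <= ln n%:R :> R by rewrite ler_ln ?posrE ?ltr0n ?ler_nat // (leq_trans m0).
rewrite -[leLHS]mulr_natl -[leRHS]mulr_natl !natrM.
have : b%:R * ln m%:R <= b%:R * ln n%:R :> R by rewrite ler_wpM2l.
have : m%:R * (2 / 3) <= m%:R * ln 2 :> R by rewrite ler_wpM2l ?ln2_ge ?ltW.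
move: hb'; lra.
Qed.

End MatchingGame.

(** * Edges of the Hamilton cycle *)

Section LinkedEdges.
Variables (n k l D : nat).
Hypothesis k_ge2 : 2 <= k.
Hypothesis l_small : 2 * l < k.
Hypothesis D_ge3 : 3 <= D.
Hypothesis nD : n = D * (k - l).

Local Notation d := (k - l).

Let d_ge2 : 2 <= d. Proof. by move: k_ge2 l_small; lia. Qed.
Let l_lt_d : l < d. Proof. by move: l_small; lia. Qed.
Let d_gt0 : 0 < d. Proof. exact: leq_trans d_ge2. Qed.

Let pos_lt (a r : nat) : a < D -> r < d -> d * a + r < n.
Proof.
move=> aD rd; rewrite nD; apply: leq_trans (_ : d * a.+1 <= _).
  by rewrite mulnS addnC ltn_add2r.
by rewrite mulnC leq_mul2r aD orbT.
Qed.

Let pos_div a r : r < d -> (d * a + r) %/ d = a.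
Proof. by move=> rd; rewrite mulnC divnMDl // divn_small // addn0. Qed.

Let pos_mod a r : r < d -> (d * a + r) %% d = r.
Proof. by move=> rd; rewrite mulnC modnMDl modn_small. Qed.

Let pos_eq (p : nat) : p = d * (p %/ d) + p %% d.
Proof. by rewrite mulnC -divn_eq. Qed.

Let pos_wrap a r : r < d -> (d * a + r) %% n = d * (a %% D) + r.
Proof.
move=> rd; rewrite -[RHS](@modn_small _ n); last by rewrite pos_lt // ltn_pmod // (leq_trans _ D_ge3).
by rewrite nD [D * _]mulnC muln_modr modnDml.
Qed.

Let class_lt (p : 'I_n) : p %/ d < D.
Proof. by rewrite ltn_divLR // -nD. Qed.

Let class (p : 'I_n) : 'I_D := Ordinal (class_lt p).

Definition on_edge (j : nat) (p : 'I_n) : bool :=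
  [exists t : 'I_k, p == (d * j + t) %% n :> nat].

(** As [l < k - l], an edge is a full block of [k - l] positions followed by the first [l] positions
    of the cyclically next block. *)
Lemma on_edgeE (j : nat) (p : 'I_n) : j < D ->
  on_edge j p = (p %/ d == j) || (p %/ d == j.+1 %% D) && (p %% d < l).
Proof.
move=> jD; apply/existsP/orP => [[t /eqP pt]|].
  case: (ltnP t d) => td.
    by left; rewrite pt modn_small ?pos_lt // pos_div.
  right; have tl : t - d < l by move: (ltn_ord t) td l_small; lia.
  have tld : t - d < d := ltn_trans tl l_lt_d.
  have -> : p = d * (j.+1 %% D) + (t - d) :> nat.
    by rewrite pt -pos_wrap // mulnSr -addnA subnKC.
  by rewrite pos_div // pos_mod // eqxx tl.
case=> [/eqP pj|/andP[/eqP pj pl]].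
  have pk : p %% d < k by apply: leq_trans (ltn_pmod p d_gt0) (leq_subr _ _).
  by exists (Ordinal pk); rewrite /= modn_small ?pos_lt ?ltn_pmod // -pj -pos_eq.
have pk : d + p %% d < k by move: pl l_small; lia.
exists (Ordinal pk); rewrite /= addnA -mulnSr pos_wrap ?ltn_pmod // -pj.
by rewrite -pos_eq.
Qed.

(* The last vertex of the [j]-th block of [k - l] consecutive vertices lies in
   the [j]-th edge only; in [linked_edge (j, x)] it is replaced by the last
   vertex of the [x]-th block. *)
Definition linked_edge (e : 'I_D * 'I_D) : {set 'I_n} :=
  [set p : 'I_n | if p %% d == d.-1 then p %/ d == e.2 else on_edge e.1 p].

Let d1 : d.-1 < d. Proof. by rewrite prednK. Qed.

(** Permutes the last vertices of the blocks by [phi] and fixes all others, which realizes the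
    matching [phi] as a vertex ordering. *)
Let reorder (phi : 'I_D -> 'I_D) (p : 'I_n) : 'I_n :=
  if p %% d == d.-1 then Ordinal (pos_lt (ltn_ord (phi (class p))) d1) else p.

Let reorder_inj (phi : 'I_D -> 'I_D) : injective phi -> injective (reorder phi).
Proof.
move=> phi_inj p p'; rewrite /reorder; case: eqP => pd; case: eqP => p'd //.
- move/(congr1 val)=> /= /addIn /eqP; rewrite eqn_mul2l => /orP[/eqP d0|/eqP /val_inj /phi_inj].
    by move: d_gt0; rewrite d0.
  move/(congr1 val)=> /= cl; apply: val_inj; rewrite /= (pos_eq p) (pos_eq p') cl.
  by rewrite pd p'd.
- by move=> /(congr1 val) /= p'E; case: p'd; rewrite -p'E pos_mod.
- by move=> /(congr1 val) /= pE; case: pd; rewrite pE pos_mod.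
Qed.

Let on_edge_last (j : 'I_D) (p : 'I_n) : p %% d = d.-1 -> on_edge j p = (class p == j).
Proof.
move=> pd; rewrite on_edgeE // pd [_ < l](_ : _ = false) ?andbF ?orbF //.
by apply/negbTE; rewrite -leqNgt -ltnS prednK.
Qed.

Let ham_edge_reorder (phi : 'I_D -> 'I_D) (phi_inj : injective phi) (j : 'I_D) :
  ham_edge k l (perm (reorder_inj phi_inj)) j = linked_edge (j, phi j).
Proof.
apply/setP=> p; rewrite inE; apply/imsetP/idP => [[i]|].
  rewrite inE permE -/(on_edge j i) => ji ->; rewrite /reorder.
  have [id|/negbTE id] := eqVneq (i %% d) d.-1; last by rewrite /= id.
  rewrite /=.
  by move: ji; rewrite on_edge_last // pos_mod // eqxx pos_div // => /eqP->.
case: eqP => pd.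
  move=> /eqP /= pj; have jlt := pos_lt (ltn_ord j) d1.
  exists (Ordinal jlt).
    by rewrite inE -/(on_edge j (Ordinal jlt)) on_edgeE //= pos_div // eqxx.
  apply: val_inj; rewrite permE /reorder /= pos_mod // eqxx /=.
  rewrite [in LHS](pos_eq p) pj pd; congr (_ * _ + _).
  by congr (val (phi _)); apply: val_inj; rewrite /= pos_div.
move=> jp; exists p; first by rewrite inE.
by rewrite permE /reorder; case: eqP.
Qed.

Lemma card_linked_edge e : #|linked_edge e| = k.
Proof.
case: e => j x.
(* Any permutation taking [j] to [x] shows that the linked edge belongs to some Hamilton cycle. *)
have tp_inj : injective (tperm j x) by apply: perm_inj.
have := ham_edge_reorder tp_inj j; rewrite tpermL => <-.
rewrite card_imset; last exact: perm_inj.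
have kn : k <= n.
  by rewrite nD; apply: leq_trans (_ : 2 * d <= _); [lia | rewrite leq_mul2r ltnW ?orbT].
have n_gt0 : 0 < n by apply: leq_trans kn; apply: leq_trans k_ge2.
pose f (t : 'I_k) : 'I_n := Ordinal (ltn_pmod (d * j + t) n_gt0).
have f_inj : injective f.
  move=> t t' /(congr1 val) /= /eqP; rewrite eqn_modDl !modn_small => [/eqP/val_inj//||];
    by apply: leq_trans (ltn_ord _) kn.
rewrite -[RHS]card_ord -(card_imset (mem 'I_k) f_inj); apply: eq_card => p.
rewrite inE; apply/existsP/imsetP => [[t /eqP pt]|[t _ ->]].
  by exists t => //; apply: val_inj.
by exists t.
Qed.

(** The only last vertex of a block in the edge determines [x]. The first vertices of the blocks
    show that [j] and [j'] are equal or each the cyclic successor of the other, and the latter fails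
    for [D >= 3]. *)
Lemma linked_edge_inj : injective linked_edge.
Proof.
move=> [j x] [j' x'] E.
have -> : x = x'.
  have xlt := pos_lt (ltn_ord x) d1.
  have : Ordinal xlt \in linked_edge (j, x) by rewrite inE /= pos_mod // eqxx pos_div.
  by rewrite E inE /= pos_mod // eqxx pos_div // => /eqP/val_inj.
have first_in (i i' : 'I_D) y y' : linked_edge (i, y) = linked_edge (i', y') ->
    (i == i') || (i == i'.+1 %% D :> nat).
  move=> E'; have ilt := pos_lt (ltn_ord i) d_gt0.
  have d10 : (0 == d.-1) = false by move: d_ge2; case: d => [|[]].
  have : Ordinal ilt \in linked_edge (i, y).
    by rewrite inE /= pos_mod // d10 on_edgeE //= pos_div // eqxx.
  rewrite E' inE /= pos_mod // d10 on_edgeE //= pos_div //.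
  by case/orP=> [ii|/andP[ii _]]; apply/orP; [left | right]; exact: ii.
congr (_, _); have := first_in _ _ _ _ E; have := first_in _ _ _ _ (esym E).
case/orP=> [/eqP->//|/eqP jj']; case/orP=> [/eqP//|/eqP j'j].
have : j = j.+2 %[mod D].
  by rewrite {1}j'j jj' modn_mod -addn1 modnDml addn1.
move/eqP; rewrite -{1}[nat_of_ord j]addn0 -addn2 eqn_modDl mod0n modn_small //.
Qed.

Lemma linked_matching_ham (Q : finType) (col : 'I_D -> Q) (M : {set 'I_D * 'I_D})
    (L : seq ({set 'I_n} * Q)) (q0 : Q) :
  injective col ->
  (forall p, p \in M -> (linked_edge p, col p.1) \in L) ->
  has_perfect_matching M -> has_rainbow_ham_cycle k l L.
Proof.
move=> col_inj ML [phi phiM].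
pose c (e : {set 'I_n}) := if [pick p | linked_edge p == e] is Some p then col p.1 else q0.
have cE p : c (linked_edge p) = col p.1.
  rewrite /c; case: pickP => [p' /eqP/linked_edge_inj->//|/(_ p)].
  by rewrite eqxx.
have nd : n %/ d = D by rewrite nD mulnK.
exists (perm (reorder_inj (@perm_inj _ phi))), c.
have cyc e : e \in ham_cycle k l (perm (reorder_inj (@perm_inj _ phi))) ->
    exists j, e = linked_edge (j, phi j).
  case/mapP=> j; rewrite mem_iota nd add0n => /andP[_ jD] ->.
  by exists (Ordinal jD); exact: (ham_edge_reorder (@perm_inj _ phi) (Ordinal jD)).
split=> [e /cyc[j ->]|e e' /cyc[j ->] /cyc[j' ->]].
  by rewrite cE; apply: ML.
by rewrite !cE => /col_inj /= ->.
Qed.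

End LinkedEdges.

(** * The rainbow Hamilton cycle game *)

Theorem theorem5 (R : realType) (k l : nat) (hk : 2 <= k) (hl : 2 * l < k) :
  exists N : nat, forall n : nat, N <= n -> (k - l) %| n ->
    forall Q : finType, #|Q| = n %/ (k - l) ->
    forall b : nat, 0 < b ->
      (b%:R <= n%:R / (2 * k%:R * ln n%:R) :> R)%R ->
      maker_wins_rainbow_ham n k l Q b.
Proof.
(* Keeping [c] abstract prevents [2 ^ 3000] from being evaluated. *)
have [c c_ge] : exists c, 3000 <= c by exists 3000.
exists (k * 2 ^ c) => n n_ge dn Q cQ b b_gt0 hb.
set D := n %/ (k - l) in cQ.
have d_gt0 : 0 < k - l by lia.
have nD : n = D * (k - l) by rewrite divnK.
have D_ge : 2 ^ c <= D.
  rewrite leq_divRL //; apply: leq_trans n_ge.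
  by rewrite mulnC leq_mul2r leq_subr orbT.
have D_ge3 : 3 <= D.
  by apply: leq_trans D_ge; apply: leq_trans (ltnW (ltn_expl c (ltnSn 1))); lia.
have n_gt1 : 1 < n.
  by rewrite nD; apply: leq_trans (leq_mul D_ge3 d_gt0).
have := bias_bound n_gt1 nD d_gt0 (leq_subr _ _) (ltnW hk) hb.
move/(matching_game R b_gt0 c_ge D_ge).
(* The [D] colors are numbered by the edges of the cycle, so distinct positions get distinct
   colors. *)
pose col (i : 'I_D) : Q := enum_val (cast_ord (esym cQ) i).
have col_inj : injective col by move=> i j /enum_val_inj /cast_ord_inj.
have D_gt0 : 0 < D by apply: leq_trans D_ge3.
apply: (@maker_wins_transfer _ _ _ _ _ (@linked_edge n k l D) (fun p => col p.1) set0 (col (Ordinal D_gt0))).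
- exact: linked_edge_inj hk hl D_ge3 nD.
- by move=> p; rewrite inE (card_linked_edge hk hl D_ge3 nD).
- move=> M L; exact: (linked_matching_ham hk hl D_ge3 nD (col (Ordinal D_gt0)) col_inj).
Qed.
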